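(* Let $t \ge 0$, let $M_0, M_1, M_2, \ldots$ be linear orders each equal to $\omega$ or $\omega^*$ which alternate, let $m_i$ be non-zero natural numbers, let $\lambda \ge \omega$ be an ordinal and $n_{t+1} \ge 1$ a natural number. Let $A = M_0^{m_0} \cdot M_1^{m_1} \cdots M_{t-1}^{m_{t-1}} \cdot M_t^{\lambda} \cdot M_{t+1}^{m_{t+1}} \cdots$ (a monomial whose terms continue after $M_{t+1}^{m_{t+1}}$) and $B = M_0^{m_0} \cdot M_1^{m_1} \cdots M_{t-1}^{m_{t-1}} \cdot M_t^{\lambda} \cdot M_{t+1}^{n_{t+1}}$. Then $A \equiv_n B$ for all $n$, so $A \equiv B$.
   Context: $\omega^*$ is the reverse of $\omega$. Products are restricted anti-lexicographic products over well-ordered index sets: for linear orders $X_i$ ($i \in I$, $I$ well-ordered) each with a designated element $0$, $\prod_{i\in I} X_i$ is the set of functions $f$ with $f(i) \in X_i$ and $f(i)=0$ for all but finitely many $i$, with $f<g$ iff for some $i$, $f(i)<g(i)$ and $f(j)=g(j)$ for all $j>i$. Factors are listed in increasing order of index (so $X\cdot Y$ is ''$Y$ copies of $X$''), and $M^\alpha$ (for an ordinal $\alpha$) stands for $\alpha$ consecutive factors equal to $M$. A monomial is such a product of a non-empty well-ordered sequence of factors. $X \equiv_n Y$ means player II wins the $n$-move Ehrenfeucht–Fraïssé game on $X$ and $Y$; $\equiv$ is elementary equivalence. *)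

(* Defs.v *)
From Stdlib Require Import Arith List RelationClasses Basics Relation_Operators
  Disjoint_Union Wf_nat Classical ProofIrrelevance FunctionalExtensionality.
Import ListNotations.

Set Implicit Arguments.

Record linear_order := LinearOrder {
  carrier :> Type;
  lt_of : carrier -> carrier -> Prop;
  lt_strict : StrictOrder lt_of;
  lt_total : forall x y, lt_of x y \/ x = y \/ lt_of y x }.

Arguments lt_of {l} _ _.
Declare Scope order_scope.
Delimit Scope order_scope with ord.
Infix "<" := lt_of : order_scope.

Record pointed_order := PointedOrder {
  porder :> linear_order;
  pt : porder }.

(* An ordinal is represented by any well-ordered type having that order type. *)
Record well_order := WellOrder {
  worder :> linear_order;
  worder_wf : well_founded (@lt_of worder) }.

Section Constructions.
Local Open Scope order_scope.

Lemma nat_lt_total (x y : nat) : Nat.lt x y \/ x = y \/ Nat.lt y x.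
Proof. destruct (Nat.lt_trichotomy x y) as [h | [h | h]]; auto. Qed.

Definition nat_order : linear_order := LinearOrder Nat.lt_strorder nat_lt_total.

Lemma reverse_total (X : linear_order) (x y : X) :
  flip lt_of x y \/ x = y \/ flip lt_of y x.
Proof. unfold flip; destruct (lt_total X x y) as [h | [h | h]]; auto. Qed.

Definition reverse (X : linear_order) : linear_order :=
  LinearOrder (flip_StrictOrder (lt_strict X)) (@reverse_total X).

(* The designated element is the endpoint: least in omega, greatest in
   omega_star. *)
Definition omega : pointed_order := @PointedOrder nat_order 0.
Definition omega_star : pointed_order := @PointedOrder (reverse nat_order) 0.

Definition ord_omega : well_order := @WellOrder nat_order lt_wf.

Definition fin_lt (n : nat) (x y : {i : nat | (i < n)%nat}) : Prop :=
  (proj1_sig x < proj1_sig y)%nat.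

Lemma fin_lt_strict n : StrictOrder (@fin_lt n).
Proof.
split; [intros x; apply Nat.lt_irrefl | intros x y z; apply Nat.lt_trans].
Qed.

Lemma fin_lt_total n (x y : {i : nat | (i < n)%nat}) :
  fin_lt x y \/ x = y \/ fin_lt y x.
Proof.
destruct x as [x hx], y as [y hy]; unfold fin_lt; simpl.
destruct (Nat.lt_trichotomy x y) as [h | [h | h]]; auto.
subst y; right; left; f_equal; apply proof_irrelevance.
Qed.

Lemma fin_lt_wf n : well_founded (@fin_lt n).
Proof. exact (well_founded_ltof _ (@proj1_sig _ _)). Qed.

Definition ord_fin (n : nat) : well_order :=
  @WellOrder (LinearOrder (fin_lt_strict n) (@fin_lt_total n)) (@fin_lt_wf n).

Definition ord_le (a b : well_order) : Prop :=
  exists f : a -> b,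
    (forall x y, x < y -> f x < f y) /\
    (forall x z, z < f x -> exists y, f y = z).

Section Sum.
Variables a b : well_order.

Notation sum_lt := (le_AsB a b (@lt_of a) (@lt_of b)).

Lemma sum_lt_wf : well_founded sum_lt.
Proof. apply wf_disjoint_sum; apply worder_wf. Qed.

Lemma sum_lt_strict : StrictOrder sum_lt.
Proof.
split.
- intros x hx; induction (sum_lt_wf x) as [x _ IH]; exact (IH x hx hx).
- intros x y z hxy hyz.
  destruct hxy; inversion hyz; subst; constructor.
  + eapply (@StrictOrder_Transitive _ _ (lt_strict a)); eauto.
  + eapply (@StrictOrder_Transitive _ _ (lt_strict b)); eauto.
Qed.

Lemma sum_lt_total x y : sum_lt x y \/ x = y \/ sum_lt y x.
Proof.
destruct x as [x | x], y as [y | y].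
- destruct (lt_total a x y) as [h | [h | h]].
  + left; now constructor.
  + subst; auto.
  + right; right; now constructor.
- left; constructor.
- right; right; constructor.
- destruct (lt_total b x y) as [h | [h | h]].
  + left; now constructor.
  + subst; auto.
  + right; right; now constructor.
Qed.

Definition ord_add : well_order :=
  @WellOrder (LinearOrder sum_lt_strict sum_lt_total) sum_lt_wf.

End Sum.

Section Product.
Variables (I : well_order) (X : I -> pointed_order).

Definition finite_support (f : forall i, X i) : Prop :=
  exists l : list I, forall i, ~ In i l -> f i = pt (X i).

Definition prod_carrier : Type := {f : forall i, X i | finite_support f}.

Definition prod_lt (f g : prod_carrier) : Prop :=
  exists i, proj1_sig f i < proj1_sig g i /\
    forall j, i < j -> proj1_sig f j = proj1_sig g j.

Lemma prod_lt_strict : StrictOrder prod_lt.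
Proof.
split.
- intros f [i [h _]]; exact (@StrictOrder_Irreflexive _ _ (lt_strict (X i)) _ h).
- intros f g h [i [hi hi']] [j [hj hj']].
  pose proof (@StrictOrder_Transitive _ _ (lt_strict I)) as trI.
  destruct (lt_total I i j) as [hij | [hij | hij]].
  + exists j; split.
    * now rewrite (hi' j hij).
    * intros k hk; rewrite <- (hj' k hk); apply hi'; eapply trI; eauto.
  + subst j; exists i; split.
    * exact (@StrictOrder_Transitive _ _ (lt_strict (X i)) _ _ _ hi hj).
    * intros k hk; now rewrite (hi' k hk), (hj' k hk).
  + exists i; split.
    * now rewrite <- (hj' i hij).
    * intros k hk; rewrite (hi' k hk); apply hj'; eapply trI; eauto.
Qed.

Lemma list_max (P : I -> Prop) (l : list I) :
  (exists i, In i l /\ P i) ->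
  exists i, P i /\ forall j, In j l -> P j -> ~ i < j.
Proof.
pose proof (@StrictOrder_Transitive _ _ (lt_strict I)) as trI.
pose proof (@StrictOrder_Irreflexive _ _ (lt_strict I)) as irI.
induction l as [| a l IH].
- intros [i [[] _]].
- intros ex.
  destruct (classic (exists i, In i l /\ P i)) as [h | h].
  + destruct (IH h) as [i [Pi maxi]].
    destruct (classic (P a /\ i < a)) as [[Pa ia] | na].
    * exists a; split; [exact Pa |].
      intros j [<- | jl] Pj aj; [exact (irI _ aj) |].
      exact (maxi j jl Pj (trI _ _ _ ia aj)).
    * exists i; split; [exact Pi |].
      intros j [<- | jl] Pj ij; [tauto | exact (maxi j jl Pj ij)].
  + destruct ex as [i [[<- | il] Pi]]; [| elim h; eauto].
    exists a; split; [exact Pi |].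
    intros j [<- | jl] Pj aj; [exact (irI _ aj) | elim h; eauto].
Qed.

Lemma prod_lt_total f g : prod_lt f g \/ f = g \/ prod_lt g f.
Proof.
destruct (classic (exists i, proj1_sig f i <> proj1_sig g i)) as [h | h].
- destruct (proj2_sig f) as [l hl], (proj2_sig g) as [l' hl'].
  assert (inl : forall i, proj1_sig f i <> proj1_sig g i -> In i (l ++ l')).
  { intros i ne; apply NNPP; rewrite in_app_iff; intros ni; apply ne.
    rewrite hl, hl'; tauto. }
  destruct (@list_max (fun i => proj1_sig f i <> proj1_sig g i) (l ++ l'))
    as [i [ne maxi]].
  { destruct h as [i ne]; eauto. }
  assert (eqj : forall j, i < j -> proj1_sig f j = proj1_sig g j).
  { intros j ij; apply NNPP; intros nj; exact (maxi j (inl j nj) nj ij). }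
  destruct (lt_total (X i) (proj1_sig f i) (proj1_sig g i)) as [k | [k | k]].
  + left; exists i; auto.
  + contradiction.
  + right; right; exists i; split; [exact k |].
    intros j ij; symmetry; auto.
- right; left; destruct f as [f hf], g as [g hg]; simpl in h.
  assert (f = g).
  { apply functional_extensionality_dep; intros i; apply NNPP; eauto. }
  subst g; f_equal; apply proof_irrelevance.
Qed.

Definition prod_order : linear_order := LinearOrder prod_lt_strict prod_lt_total.

End Product.

End Constructions.

Record factors := Factors {
  index : well_order;
  factor : index -> pointed_order }.

Arguments factor : clear implicits.

(* The order denoted by the formal product of a sequence of factors. *)
Definition product (u : factors) : linear_order := prod_order (index u) (factor u).

Definition power (X : pointed_order) (a : well_order) : factors :=
  @Factors a (fun _ => X).

Definition concat (u v : factors) : factors :=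
  @Factors (ord_add (index u) (index v))
    (fun i => match i with inl i => factor u i | inr j => factor v j end).

Declare Scope factors_scope.
Delimit Scope factors_scope with fac.
Bind Scope factors_scope with factors.
Infix "**" := concat (at level 35, right associativity) : factors_scope.

(* [prepend M m t u] is M_0^{m_0} ** ... ** M_{t-1}^{m_{t-1}} ** u. *)
Fixpoint prepend (M : nat -> pointed_order) (m : nat -> nat) (t : nat)
    (u : factors) : factors :=
  match t with
  | O => u
  | S t' => prepend M m t' (power (M t') (ord_fin (m t')) ** u)%fac
  end.

Definition omega_or_star (X : pointed_order) : Prop :=
  X = omega \/ X = omega_star.

Section Game.
Variables X Y : linear_order.
Local Open Scope order_scope.

Definition partial_iso (s : list (X * Y)) : Prop :=
  forall p q, In p s -> In q s ->
    (fst p = fst q <-> snd p = snd q) /\ (fst p < fst q <-> snd p < snd q).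

(* Player II wins from the position [s] when [n] moves remain: at each move
   player I picks an element of either structure and II replies in the other. *)
Fixpoint II_wins (n : nat) (s : list (X * Y)) : Prop :=
  match n with
  | O => partial_iso s
  | S k => (forall x, exists y, II_wins k ((x, y) :: s)) /\
           (forall y, exists x, II_wins k ((x, y) :: s))
  end.

Definition ef_equiv (n : nat) : Prop := II_wins n [].

End Game.

(* First-order formulas in the language of orders, with free variables in [V];
   a quantifier binds the variable [None] of [option V]. *)
Inductive formula (V : Set) : Set :=
| FEq (x y : V)
| FLt (x y : V)
| FNot (p : formula V)
| FAnd (p q : formula V)
| FOr (p q : formula V)
| FImp (p q : formula V)
| FAll (p : formula (option V))
| FEx (p : formula (option V)).

Definition extend (V : Set) (X : Type) (v : V -> X) (x : X) (o : option V) : X :=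
  match o with None => x | Some y => v y end.

Fixpoint sat (X : linear_order) (V : Set) (p : formula V) : (V -> X) -> Prop :=
  match p with
  | FEq x y => fun v => v x = v y
  | FLt x y => fun v => (v x < v y)%ord
  | FNot p => fun v => ~ sat X p v
  | FAnd p q => fun v => sat X p v /\ sat X q v
  | FOr p q => fun v => sat X p v \/ sat X q v
  | FImp p q => fun v => sat X p v -> sat X q v
  | FAll p => fun v => forall x, sat X p (extend v x)
  | FEx p => fun v => exists x, sat X p (extend v x)
  end.

Definition sentence : Set := formula Empty_set.

Definition models (X : linear_order) (p : sentence) : Prop :=
  sat X p (fun v : Empty_set => match v with end).

Definition elem_equiv (X Y : linear_order) : Prop :=
  forall p : sentence, models X p <-> models Y p.

(* Main.v *)
(* With omega as [M t], write the two products as [P * (omega^lambda * X)] and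
   [P * (omega^lambda * Y)]: the orders [X] and [Y] start with a factor
   omega_star, so they have no least element, and nothing else about them
   matters.  The common prefix [P] is harmless: II copies its coordinate.  On
   omega^lambda * X and omega^lambda * Y, II maintains, with [k] moves left, that
   corresponding elements have the same first [k] digits and that erasing these
   digits yields a partial isomorphism.  If I plays an element whose truncation
   at [k+1] digits is new, II takes the truncation of the closest played element
   below it and a digit [k] larger than all those played; if there is none below,
   II uses that [X] and [Y] have no least element.  The case of omega_star
   follows by reversing all orders. *)
From Stdlib Require Import Arith Lia List RelationClasses Basics Classical ClassicalEpsilon
  ProofIrrelevance FunctionalExtensionality.
Require Import Defs.
Import ListNotations.

Set Implicit Arguments.
Unset Strict Implicit.

Local Open Scope order_scope.

(** * Linear orders and finite lists of their elements *)

Lemma order_irrefl (X : linear_order) (x : X) : ~ x < x.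
Proof. exact (@StrictOrder_Irreflexive _ _ (lt_strict X) x). Qed.

Lemma order_trans (X : linear_order) (x y z : X) : x < y -> y < z -> x < z.
Proof. exact (@StrictOrder_Transitive _ _ (lt_strict X) x y z). Qed.

Lemma order_asym (X : linear_order) (x y : X) : x < y -> ~ y < x.
Proof. intros h h'; exact (order_irrefl (order_trans h h')). Qed.

Definition no_min (X : linear_order) : Prop := forall x : X, exists y, y < x.

(** Induction on [l], keeping the smaller of two bounds; [x0] answers the empty list. On reversed
    orders this yields strict upper bounds. *)
Lemma no_min_list (X : linear_order) (x0 : X) (l : list X) :
  no_min X -> exists y, forall x, In x l -> y < x.
Proof.
intros hX; induction l as [| a l [y hy]].
- exists x0; intros x [].
- destruct (hX a) as [b hb].
  destruct (lt_total X y b) as [h | [h | h]].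
  + exists y; intros x [<- | hx]; [exact (order_trans h hb) | auto].
  + subst b; exists y; intros x [<- | hx]; auto.
  + exists b; intros x [<- | hx]; [exact hb | exact (order_trans h (hy x hx))].
Qed.

Lemma exists_max_below (T : Type) (X : linear_order) (f : T -> X) (x : X) (l : list T) :
  (forall p, In p l -> ~ f p < x) \/
  exists p, In p l /\ f p < x /\ forall q, In q l -> f q < x -> ~ f p < f q.
Proof.
induction l as [| a l IH].
- left; intros p [].
- destruct (classic (f a < x)) as [ha | ha].
  + right; destruct IH as [IH | (p & hp & hpx & hmax)].
    * exists a; split; [now left | split; [exact ha |]].
      intros q [<- | hq] hqx; [apply order_irrefl | elim (IH q hq hqx)].
    * destruct (classic (f p < f a)) as [hpa | hpa].
      -- exists a; split; [now left | split; [exact ha |]].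
         intros q [<- | hq] hqx h; [exact (order_irrefl h) |].
         exact (hmax q hq hqx (order_trans hpa h)).
      -- exists p; split; [now right | split; [exact hpx |]].
         intros q [<- | hq] hqx; [exact hpa | auto].
  + destruct IH as [IH | (p & hp & hpx & hmax)].
    * left; intros p [<- | hp]; auto.
    * right; exists p; split; [now right | split; [exact hpx |]].
      intros q [<- | hq] hqx; [contradiction | auto].
Qed.

(** * Positions of the game and back-and-forth systems *)

Definition same_order (X Y : linear_order) (x x' : X) (y y' : Y) : Prop :=
  (x < x' /\ y < y') \/ (x = x' /\ y = y') \/ (x' < x /\ y' < y).

Lemma same_order_sym (X Y : linear_order) (x x' : X) (y y' : Y) :
  same_order x x' y y' -> same_order x' x y' y.
Proof. unfold same_order; intuition. Qed.

Lemma same_order_flip (X Y : linear_order) (x x' : X) (y y' : Y) :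
  same_order x x' y y' -> same_order y y' x x'.
Proof. unfold same_order; intuition. Qed.

(** By trichotomy, the pairwise condition of [partial_iso] becomes a disjunction of three matching
    cases, which is easier to split on. *)
Lemma same_order_iff (X Y : linear_order) (x x' : X) (y y' : Y) :
  same_order x x' y y' <-> (x = x' <-> y = y') /\ (x < x' <-> y < y').
Proof.
pose proof (order_irrefl (X := X)) as iX; pose proof (order_irrefl (X := Y)) as iY.
pose proof (order_asym (X := X)) as aX; pose proof (order_asym (X := Y)) as aY.
unfold same_order; split.
- intros [[h k] | [[-> ->] | [h k]]].
  + assert (x <> x') by (intros ->; exact (iX _ h)).
    assert (y <> y') by (intros ->; exact (iY _ k)); tauto.
  + specialize (iX x'); specialize (iY y'); tauto.
  + assert (x <> x') by (intros ->; exact (iX _ h)).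
    assert (y <> y') by (intros ->; exact (iY _ k)).
    specialize (aX _ _ h); specialize (aY _ _ k); tauto.
- intros [he hl].
  destruct (lt_total X x x') as [h | [h | h]]; [tauto | tauto |].
  right; right; split; [exact h |].
  destruct (lt_total Y y y') as [k | [k | k]]; [| | exact k].
  + elim (aX _ _ h); tauto.
  + apply he in k; subst x'; elim (iX _ h).
Qed.

Lemma partial_iso_iff (X Y : linear_order) (s : list (X * Y)) :
  partial_iso X Y s <->
  forall p q, In p s -> In q s -> same_order (fst p) (fst q) (snd p) (snd q).
Proof. unfold partial_iso; split; intros h p q hp hq; apply same_order_iff; auto. Qed.

(** [P k s] is an invariant for positions [s] with [k] moves left; II wins by restoring it after
    every move. *)
Lemma II_wins_system (X Y : linear_order) (P : nat -> list (X * Y) -> Prop) :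
  (forall s, P 0 s -> partial_iso X Y s) ->
  (forall k s x, P (S k) s -> exists y, P k ((x, y) :: s)) ->
  (forall k s y, P (S k) s -> exists x, P k ((x, y) :: s)) ->
  forall n s, P n s -> II_wins X Y n s.
Proof.
intros h0 hforth hback; induction n as [| n IH]; intros s hs; [exact (h0 s hs) |].
split.
- intros x; destruct (hforth n s x hs) as [y hy]; exists y; auto.
- intros y; destruct (hback n s y hs) as [x hx]; exists x; auto.
Qed.

Lemma II_wins_partial_iso (X Y : linear_order) (n : nat) (s : list (X * Y)) :
  II_wins X Y n s -> partial_iso X Y s.
Proof.
revert s; induction n as [| n IH]; intros s hs; [exact hs |].
(* The empty position is trivially a partial isomorphism. Otherwise I can replay [x], and the longer
   position contains [s]. *)
destruct s as [| [x y] s]; [intros p q [] |].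
destruct (proj1 hs x) as [z hz]; apply IH in hz.
intros p q hp hq; apply hz; now right.
Qed.

(** * From games to first-order sentences *)

Section Elementary.
Variables X Y : linear_order.

Fixpoint quantifier_depth (V : Set) (p : formula V) : nat :=
  match p with
  | FEq _ _ | FLt _ _ => 0
  | FNot p => quantifier_depth p
  | FAnd p q | FOr p q | FImp p q => Nat.max (quantifier_depth p) (quantifier_depth q)
  | FAll p | FEx p => S (quantifier_depth p)
  end.

(** One half of the Ehrenfeucht-Fraïssé theorem: each quantifier costs one move, and the pair played
    gives the values of the bound variable. *)
Lemma II_wins_sat (V : Set) (p : formula V) :
  forall n s (v : V -> X) (w : V -> Y),
    (quantifier_depth p <= n)%nat -> II_wins X Y n s ->
    (forall i, In (v i, w i) s) -> sat X p v <-> sat Y p w.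
Proof.
induction p as [V i j | V i j | V p IHp | V p IHp q IHq | V p IHp q IHq
  | V p IHp q IHq | V p IHp | V p IHp]; simpl; intros n s v w hn hs hv.
- exact (proj1 (II_wins_partial_iso hs (hv i) (hv j))).
- exact (proj2 (II_wins_partial_iso hs (hv i) (hv j))).
- rewrite (IHp n s v w); auto; tauto.
- rewrite (IHp n s v w), (IHq n s v w); auto; try lia; tauto.
- rewrite (IHp n s v w), (IHq n s v w); auto; try lia; tauto.
- rewrite (IHp n s v w), (IHq n s v w); auto; try lia; tauto.
- destruct n as [| n]; [lia |].
  assert (step : forall x y, II_wins X Y n ((x, y) :: s) ->
    sat X p (extend v x) <-> sat Y p (extend w y)).
  { intros x y h; apply (IHp n ((x, y) :: s)); [lia | exact h |].
    intros [i |]; simpl; auto. }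
  destruct hs as [h1 h2]; split; intros h z.
  + destruct (h2 z) as [x hx]; apply (step x z hx); auto.
  + destruct (h1 z) as [y hy]; apply (step z y hy); auto.
- destruct n as [| n]; [lia |].
  assert (step : forall x y, II_wins X Y n ((x, y) :: s) ->
    sat X p (extend v x) <-> sat Y p (extend w y)).
  { intros x y h; apply (IHp n ((x, y) :: s)); [lia | exact h |].
    intros [i |]; simpl; auto. }
  destruct hs as [h1 h2]; split; intros [z hz].
  + destruct (h1 z) as [y hy]; exists y; now apply (step z y hy).
  + destruct (h2 z) as [x hx]; exists x; now apply (step x z hx).
Qed.

Lemma ef_equiv_elem_equiv : (forall n, ef_equiv X Y n) -> elem_equiv X Y.
Proof.
intros h p; apply (@II_wins_sat _ p (quantifier_depth p) []); auto.
- apply h.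
- intros [].
Qed.

End Elementary.

(** * Isomorphisms and reversal *)

Definition strict_embedding (X Y : linear_order) (f : X -> Y) : Prop :=
  forall x y, x < y -> f x < f y.

Lemma same_order_embedding (X Y X' Y' : linear_order) (f : X -> X') (g : Y -> Y') x x' y y' :
  strict_embedding f -> strict_embedding g ->
  same_order x x' y y' -> same_order (f x) (f x') (g y) (g y').
Proof.
intros hf hg [[h k] | [[-> ->] | [h k]]]; unfold same_order; auto.
Qed.

(** A strictly increasing surjection between linear orders is an isomorphism, so II plays the images
    of a winning position. *)
Lemma ef_equiv_iso (X Y X' Y' : linear_order) (f : X -> X') (g : Y -> Y') (n : nat) :
  strict_embedding f -> (forall x', exists x, f x = x') ->
  strict_embedding g -> (forall y', exists y, g y = y') ->
  ef_equiv X Y n -> ef_equiv X' Y' n.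
Proof.
intros hf sf hg sg h.
apply (@II_wins_system X' Y' (fun k s' => exists s, II_wins X Y k s /\
  s' = map (fun p => (f (fst p), g (snd p))) s)).
- intros s' (s & hs & ->); apply partial_iso_iff; intros p' q' hp hq.
  apply in_map_iff in hp; apply in_map_iff in hq.
  destruct hp as (p & <- & hp), hq as (q & <- & hq); simpl.
  apply same_order_embedding; auto.
  exact (proj1 (partial_iso_iff s) hs p q hp hq).
- intros k s' x' (s & hs & ->); destruct (sf x') as [x <-].
  destruct (proj1 hs x) as [y hy]; exists (g y), ((x, y) :: s); auto.
- intros k s' y' (s & hs & ->); destruct (sg y') as [y <-].
  destruct (proj2 hs y) as [x hx]; exists (f x), ((x, y) :: s); auto.
- exists []; auto.
Qed.

Lemma II_wins_reverse (X Y : linear_order) (n : nat) (s : list (X * Y)) :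
  II_wins (reverse X) (reverse Y) n s -> II_wins X Y n s.
Proof.
revert s; induction n as [| n IH]; intros s hs.
- intros p q hp hq.
  (* Comparing [p] with [q] amounts to comparing [q] with [p] in the reversed orders. *)
  exact (conj (proj1 (hs p q hp hq)) (proj2 (hs q p hq hp))).
- destruct hs as [h1 h2]; split.
  + intros x; destruct (h1 x) as [y hy]; exists y; auto.
  + intros y; destruct (h2 y) as [x hx]; exists x; auto.
Qed.

(** * Lexicographic products of two orders *)

Section Lex.
Variables X Y : linear_order.

Definition lex_lt (p q : X * Y) : Prop :=
  snd p < snd q \/ (snd p = snd q /\ fst p < fst q).

Lemma lex_strict : StrictOrder lex_lt.
Proof.
split.
- intros p [h | [_ h]]; exact (order_irrefl h).
- intros p q r [h | [h h']] [k | [k k']]; unfold lex_lt.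
  + left; exact (order_trans h k).
  + left; now rewrite <- k.
  + left; now rewrite h.
  + right; split; [congruence | exact (order_trans h' k')].
Qed.

Lemma lex_total p q : lex_lt p q \/ p = q \/ lex_lt q p.
Proof.
destruct p as [x y], q as [x' y']; unfold lex_lt; simpl.
destruct (lt_total Y y y') as [h | [-> | h]]; [tauto | | tauto].
destruct (lt_total X x x') as [h | [-> | h]]; tauto.
Qed.

(* [Y] copies of [X], the paper's [X . Y] *)
Definition lex : linear_order := LinearOrder lex_strict lex_total.

End Lex.

(** The invariant lists triples: the coordinate in [P] is stored once, since II copies it, and the
    remaining pairs form a winning position. When these pairs tie, they tie on both sides, and the
    common coordinate decides. *)
Lemma ef_equiv_lex (P X Y : linear_order) (n : nat) :
  ef_equiv X Y n -> ef_equiv (lex P X) (lex P Y) n.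
Proof.
intros h.
apply (@II_wins_system (lex P X) (lex P Y) (fun k s' => exists s : list (P * (X * Y)),
  II_wins X Y k (map snd s) /\
  s' = map (fun p => ((fst p, fst (snd p)), (fst p, snd (snd p)))) s)).
- intros s' (s & hs & ->); apply partial_iso_iff; intros p' q' hp hq.
  apply in_map_iff in hp; apply in_map_iff in hq.
  destruct hp as ([a xy] & <- & hp), hq as ([b xy'] & <- & hq).
  pose proof (proj1 (partial_iso_iff _) hs _ _ (in_map snd _ _ hp)
    (in_map snd _ _ hq)) as hxy; simpl in hxy |- *.
  unfold same_order; simpl; unfold lex_lt; simpl.
  destruct hxy as [[e e'] | [[e e'] | [e e']]]; [tauto | | tauto].
  rewrite e, e'; destruct (lt_total P a b) as [k | [-> | k]]; tauto.
- intros k s' [a x] (s & hs & ->).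
  destruct (proj1 hs x) as [y hy]; exists (a, y), ((a, (x, y)) :: s); auto.
- intros k s' [a y] (s & hs & ->).
  destruct (proj2 hs y) as [x hx]; exists (a, x), ((a, (x, y)) :: s); auto.
- exists []; auto.
Qed.

(** * Formal products: concatenation and endpoints *)

Definition base_point (u : factors) : product u :=
  exist _ (fun i => pt (factor u i)) (ex_intro _ [] (fun i _ => eq_refl)).

Lemma product_ext (u : factors) (f g : product u) :
  (forall i, proj1_sig f i = proj1_sig g i) -> f = g.
Proof.
destruct f as [f hf], g as [g hg]; simpl; intros h.
assert (f = g) by (apply functional_extensionality_dep; exact h).
subst g; f_equal; apply proof_irrelevance.
Qed.

Section Glue.
Variables u v : factors.

Lemma glue_support (f : product u) (g : product v) :
  finite_support (index (u ** v)) (factor (u ** v))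
    (fun i => match i return factor (u ** v) i with
              | inl i => proj1_sig f i | inr j => proj1_sig g j end).
Proof.
destruct f as [f [l hl]], g as [g [l' hl']]; simpl.
exists (map inl l ++ map inr l'); intros i hi; rewrite in_app_iff in hi.
destruct i as [i | i]; [apply hl | apply hl']; intros h; apply hi;
  [left | right]; now apply in_map.
Qed.

(** An isomorphism, by the two lemmas that follow: the indices of [v] come after those of [u], so
    the coordinates in [v] decide first. *)
Definition glue (p : lex (product u) (product v)) : product (u ** v) :=
  exist _ _ (glue_support (fst p) (snd p)).

Lemma glue_embedding : strict_embedding glue.
Proof.
intros [f g] [f' g'] [(i & hi & hj) | [e (i & hi & hj)]]; simpl in *.
- exists (inr i); split; [exact hi |].
  intros [j | j] hij; [inversion hij | apply hj]; now inversion hij.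
- subst g'; exists (inl i); split; [exact hi |].
  intros [j | j] hij; [apply hj; now inversion hij | reflexivity].
Qed.

Lemma glue_surjective (h : product (u ** v)) : exists p, glue p = h.
Proof.
destruct h as [h [l hl]].
assert (hf : finite_support (index u) (factor u) (fun i => h (inl i))).
{ exists (flat_map (fun i => match i with inl i => [i] | inr _ => [] end) l).
  intros i hi; apply (hl (inl i)); intros hin; apply hi, in_flat_map.
  exists (inl i); simpl; auto. }
assert (hg : finite_support (index v) (factor v) (fun i => h (inr i))).
{ exists (flat_map (fun i => match i with inl _ => [] | inr i => [i] end) l).
  intros i hi; apply (hl (inr i)); intros hin; apply hi, in_flat_map.
  exists (inr i); simpl; auto. }
exists (exist _ _ hf, exist _ _ hg).
apply product_ext; now intros [i | i].
Qed.

End Glue.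

Lemma ef_equiv_concat (u u' v v' : factors) (n : nat) :
  ef_equiv (lex (product u) (product v)) (lex (product u') (product v')) n ->
  ef_equiv (product (u ** v)) (product (u' ** v')) n.
Proof.
exact (ef_equiv_iso (@glue_embedding u v) (@glue_surjective u v)
  (@glue_embedding u' v') (@glue_surjective u' v')).
Qed.

(** It suffices to lower the less significant part. *)
Lemma no_min_concat (u v : factors) : no_min (product u) -> no_min (product (u ** v)).
Proof.
intros h f; destruct (glue_surjective f) as [[a b] <-]; destruct (h a) as [c hc].
exists (glue (c, b)); apply glue_embedding; right; auto.
Qed.

Lemma no_max_concat (u v : factors) :
  no_min (reverse (product u)) -> no_min (reverse (product (u ** v))).
Proof.
intros h f; destruct (glue_surjective f) as [[a b] <-]; destruct (h a) as [c hc].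
exists (glue (c, b)); apply (@glue_embedding u v (a, b) (c, b)); right; auto.
Qed.

Lemma ef_equiv_prepend M m t (u v : factors) (n : nat) :
  ef_equiv (product u) (product v) n ->
  ef_equiv (product (prepend M m t u)) (product (prepend M m t v)) n.
Proof.
revert u v; induction t as [| t IH]; intros u v h; simpl; [exact h |].
apply IH, ef_equiv_concat, ef_equiv_lex, h.
Qed.

(** Lowering the coordinate at [i] alone lowers the function, and enlarges the support by at most
    [i]. *)
Lemma no_min_power (M : pointed_order) (a : well_order) (i : a) :
  no_min M -> no_min (product (power M a)).
Proof.
intros hM [f [l hl]]; simpl in *.
destruct (hM (f i)) as [c hc].
set (g := fun j : a => if excluded_middle_informative (j = i) then c else f j).
assert (hg : finite_support a (fun _ => M) g).
{ exists (i :: l); intros j hj; unfold g.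
  destruct (excluded_middle_informative (j = i)) as [-> | ne].
  - elim hj; now left.
  - apply hl; intros h; apply hj; now right. }
exists (exist _ g hg), i; simpl; unfold g; split.
- destruct (excluded_middle_informative (i = i)); [exact hc | contradiction].
- intros j hij; destruct (excluded_middle_informative (j = i)) as [-> | ne]; auto.
  elim (order_irrefl hij).
Qed.

Lemma no_min_omega_star : no_min omega_star.
Proof. intros x; exists (S x); apply Nat.lt_succ_diag_r. Qed.

(** Powers of [omega] and [omega_star] consist of the same functions in opposite orders. *)
Lemma no_max_power_omega (a : well_order) (i : a) :
  no_min (reverse (product (power omega a))).
Proof.
intros f; destruct (no_min_power i no_min_omega_star f) as (g & j & hj & hjk).
exists g, j; split; [exact hj | intros k hk; symmetry; exact (hjk k hk)].
Qed.

(** * The lowest digits in a power of infinite exponent *)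

Section Digits.
Variables (M : pointed_order) (lambda : well_order) (e : nat -> lambda).
Hypothesis e_mono : forall x y : nat, (x < y)%nat -> e x < e y.
Hypothesis e_initial : forall x z, z < e x -> exists y, e y = z.

(** [e] enumerates the initial segment of type omega of [lambda]; these are its first [k]
    positions. *)
Definition among_first (k : nat) (j : lambda) : Prop := exists i, (i < k)%nat /\ e i = j.

Lemma e_reflect x y : e x < e y -> (x < y)%nat.
Proof.
intros h; destruct (Nat.lt_trichotomy x y) as [k | [-> | k]]; [exact k | |].
- elim (order_irrefl h).
- elim (order_asym h (e_mono k)).
Qed.

Lemma e_injective x y : e x = e y -> x = y.
Proof.
intros h; destruct (Nat.lt_trichotomy x y) as [k | [k | k]]; [| exact k |];
  apply e_mono in k; rewrite h in k; elim (order_irrefl k).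
Qed.

Lemma among_first_down k i j : i < j -> among_first k j -> among_first k i.
Proof.
intros hij (x & hx & <-); destruct (e_initial hij) as [y <-].
exists y; split; [| reflexivity]; apply e_reflect in hij; lia.
Qed.

Lemma among_first_S k j : among_first (S k) j <-> j = e k \/ among_first k j.
Proof.
split.
- intros (i & hi & <-); destruct (Nat.eq_dec i k) as [-> | ne]; [now left |].
  right; exists i; split; [lia | reflexivity].
- intros [-> | (i & hi & <-)]; [exists k | exists i]; split; auto; lia.
Qed.

Lemma not_among_first k : ~ among_first k (e k).
Proof. intros (i & hi & h); apply e_injective in h; lia. Qed.

Notation digits := (product (power M lambda)).

(** The number of a position is recovered by choice, unambiguously since [e] is injective. *)
Definition replace_fun (k : nat) (d : nat -> M) (a : digits) (j : lambda) : M :=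
  match excluded_middle_informative (among_first k j) with
  | left h => d (proj1_sig (constructive_indefinite_description _ h))
  | right _ => proj1_sig a j
  end.

Lemma replace_support k d a : finite_support lambda (fun _ => M) (replace_fun k d a).
Proof.
destruct a as [a [l hl]]; exists (map e (seq 0 k) ++ l); intros j hj.
unfold replace_fun; rewrite in_app_iff in hj.
destruct (excluded_middle_informative (among_first k j)) as [h | h].
- elim hj; left; destruct h as (i & hi & <-).
  apply in_map, in_seq; lia.
- apply hl; tauto.
Qed.

Definition replace k d a : digits := exist _ _ (replace_support k d a).

Lemma replace_in k d a i : (i < k)%nat -> proj1_sig (replace k d a) (e i) = d i.
Proof.
intros hi; simpl; unfold replace_fun.
destruct (excluded_middle_informative (among_first k (e i))) as [h | h].
- destruct (constructive_indefinite_description _ h) as (x & hx & hxi); simpl.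
  now rewrite (e_injective hxi).
- elim h; exists i; auto.
Qed.

Lemma replace_out k d a j : ~ among_first k j -> proj1_sig (replace k d a) j = proj1_sig a j.
Proof.
intros hj; simpl; unfold replace_fun.
destruct (excluded_middle_informative (among_first k j)); tauto.
Qed.

(** Erased digits are reset to the designated point rather than dropped, so erasures for all [k]
    live in the same order. *)
Definition erase k (a : digits) : digits := replace k (fun _ => pt M) a.

Lemma erase_eq_iff k (a b : digits) : erase k a = erase k b <->
  forall j, ~ among_first k j -> proj1_sig a j = proj1_sig b j.
Proof.
split.
- intros h j hj; rewrite <- (replace_out (fun _ => pt M) a hj).
  change (proj1_sig (erase k a) j = proj1_sig b j).
  rewrite h; now apply replace_out.
- intros h; apply product_ext; intros j.
  destruct (classic (among_first k j)) as [(i & hi & <-) | hj]; unfold erase.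
  + now rewrite !replace_in.
  + rewrite !replace_out; auto.
Qed.

(** * Truncation and its effect on the order *)

Section Truncation.
Variable X : linear_order.
Notation Z := (lex digits X).

Definition digit (i : nat) (z : Z) : M := proj1_sig (fst z) (e i).

Definition truncate (k : nat) (z : Z) : Z := (erase k (fst z), snd z).

(** Passing from [S k] to [k] restores only the digit at [e k]. *)
Lemma truncate_eq k (z w : Z) :
  truncate (S k) z = truncate (S k) w -> digit k z = digit k w ->
  truncate k z = truncate k w.
Proof.
destruct z as [a x], w as [b y]; unfold truncate, digit; simpl.
intros h0 hd; pose proof (f_equal fst h0) as h; pose proof (f_equal snd h0) as hxy.
simpl in h, hxy; subst y; f_equal.
apply erase_eq_iff; intros j hj.
destruct (classic (j = e k)) as [-> | ne]; [exact hd |].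
apply (proj1 (erase_eq_iff (S k) a b) h); rewrite among_first_S; tauto.
Qed.

Lemma truncate_lt_digit k (z w : Z) :
  truncate (S k) z = truncate (S k) w -> digit k z < digit k w ->
  truncate k z < truncate k w.
Proof.
destruct z as [a x], w as [b y]; unfold truncate, digit; simpl.
intros h0 hd; pose proof (f_equal fst h0) as h; pose proof (f_equal snd h0) as hxy.
simpl in h, hxy; subst y; right; simpl; split; [reflexivity |].
exists (e k); unfold erase; rewrite !replace_out by apply not_among_first.
split; [exact hd |]; intros j hj.
assert (hjk : ~ among_first (S k) j).
{ intros h'; apply (not_among_first (k := S k)).
  destruct h' as (i & hi & <-); apply e_reflect in hj; lia. }
pose proof (proj1 (erase_eq_iff (S k) a b) h j hjk) as hab.
rewrite among_first_S in hjk; rewrite !replace_out; tauto.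
Qed.

(** The deciding coordinate is not an erased one, since erased digits are equal. The erased
    positions are closed downwards, so all coordinates from the deciding one up are unaffected by
    restoring digit [k]. *)
Lemma truncate_lt k (z w : Z) :
  truncate (S k) z < truncate (S k) w -> truncate k z < truncate k w.
Proof.
destruct z as [a x], w as [b y]; unfold truncate; simpl.
intros [h | [h (i & hi & hj)]]; simpl in *; [now left |].
right; split; [exact h |]; simpl.
assert (hiS : ~ among_first (S k) i).
{ intros (n & hn & <-).
  pose proof (@replace_in (S k) (fun _ => pt M) a n hn) as ha.
  pose proof (@replace_in (S k) (fun _ => pt M) b n hn) as hb.
  simpl in ha, hb; rewrite ha, hb in hi; exact (order_irrefl hi). }
assert (hout : forall j, ~ among_first (S k) j -> forall c : digits,
  replace_fun k (fun _ => pt M) c j = replace_fun (S k) (fun _ => pt M) c j).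
{ intros j hjS c; pose proof hjS as hjk; rewrite among_first_S in hjk.
  pose proof (@replace_out (S k) (fun _ => pt M) c j hjS) as h1.
  assert (hjk' : ~ among_first k j) by tauto.
  pose proof (@replace_out k (fun _ => pt M) c j hjk') as h2.
  simpl in h1, h2; congruence. }
exists i; simpl; split.
- now rewrite !hout.
- intros j hij; rewrite !hout; auto;
    intros hjS; exact (hiS (among_first_down hij hjS)).
Qed.

Lemma truncate_0 (z : Z) : truncate 0 z = z.
Proof.
destruct z as [a x]; unfold truncate; simpl; f_equal; apply product_ext.
intros j; apply replace_out; intros (i & hi & _); lia.
Qed.

(** Provides II's replies: a truncation and the digits below it can be prescribed independently. *)
Lemma truncate_replace k (d : nat -> M) (z : Z) :
  exists w, truncate k w = truncate k z /\ forall i, (i < k)%nat -> digit i w = d i.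
Proof.
destruct z as [a x]; exists (replace k d a, x); split.
- unfold truncate; simpl; f_equal; apply erase_eq_iff; intros j hj.
  now apply replace_out.
- intros i hi; now apply replace_in.
Qed.

(** The coordinate in [X] is the most significant, so one below all those in [l] suffices whatever
    the digits. *)
Lemma truncate_below (x0 : X) k (l : list Z) : no_min X ->
  exists w, forall z, In z l -> truncate k w < truncate k z.
Proof.
intros hX; destruct (no_min_list x0 (map snd l) hX) as [y hy].
exists (base_point (power M lambda), y); intros z hz; left; simpl.
now apply hy, in_map.
Qed.

End Truncation.

(** * The back-and-forth strategy *)

Section Strategy.
Variables X Y : linear_order.
Notation A := (lex digits X).
Notation B := (lex digits Y).

Definition agree (k : nat) (s : list (A * B)) : Prop :=
  (forall p, In p s -> forall i, (i < k)%nat -> digit i (fst p) = digit i (snd p)) /\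
  (forall p q, In p s -> In q s -> same_order
     (truncate k (fst p)) (truncate k (fst q)) (truncate k (snd p)) (truncate k (snd q))).

(** Strict inequalities survive restoring digit [k]; ties are broken by that digit, which
    corresponding elements share. *)
Lemma same_order_truncate k (z w : A) (z' w' : B) :
  same_order (truncate (S k) z) (truncate (S k) w)
    (truncate (S k) z') (truncate (S k) w') ->
  digit k z = digit k z' -> digit k w = digit k w' ->
  same_order (truncate k z) (truncate k w) (truncate k z') (truncate k w').
Proof.
intros h hz hw; destruct h as [[h h'] | [[h h'] | [h h']]].
- left; split; now apply truncate_lt.
- destruct (lt_total M (digit k z) (digit k w)) as [l | [l | l]].
  + left; split; apply truncate_lt_digit; auto; congruence.
  + right; left; split; apply truncate_eq; auto; congruence.
  + right; right; split; apply truncate_lt_digit; auto; congruence.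
- right; right; split; now apply truncate_lt.
Qed.

(** Pairs already played satisfy the weaker invariant automatically, so only comparisons with the
    new pair remain. *)
Lemma agree_cons k s z z' : agree (S k) s ->
  (forall i, (i < k)%nat -> digit i z = digit i z') ->
  (forall q, In q s -> same_order
     (truncate k z) (truncate k (fst q)) (truncate k z') (truncate k (snd q))) ->
  agree k ((z, z') :: s).
Proof.
intros [hd ho] hz hq; split.
- intros p [<- | hp] i hi; simpl; [auto | apply hd; auto].
- intros p q [<- | hp] [<- | hq']; simpl.
  + right; left; auto.
  + auto.
  + now apply same_order_sym, hq.
  + apply same_order_truncate; auto.
Qed.

Lemma agree_forth (y0 : Y) :
  (forall l : list M, exists c, forall x, In x l -> x < c) -> no_min Y ->
  forall k s z, agree (S k) s -> exists z', agree k ((z, z') :: s).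
Proof.
intros hM hY k s z hs; pose proof hs as [hd ho].
destruct (classic (exists p, In p s /\ truncate (S k) (fst p) = truncate (S k) z))
  as [(p & hp & hpz) | new].
(* The truncation of [z] was already played: the reply takes the partner's truncation and copies
   digit [k] too, which breaks ties identically on both sides. *)
- destruct (truncate_replace (S k) (fun i => digit i z) (snd p)) as (z' & hz' & hdz').
  exists z'; apply agree_cons; auto.
  + intros i hi; rewrite hdz'; auto.
  + intros q hq; apply same_order_truncate; auto.
    * rewrite <- hpz, hz'; auto.
    * rewrite hdz'; auto.
- destruct (exists_max_below (fun p : A * B => truncate (S k) (fst p)) (truncate (S k) z) s)
    as [hnone | (p & hp & hpz & hmax)].
  + destruct (truncate_below y0 (S k) (map snd s) hY) as [w hw].
    destruct (truncate_replace (S k) (fun i => digit i z) w) as (z' & hz' & hdz').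
    exists z'; apply agree_cons; auto.
    * intros i hi; rewrite hdz'; auto.
    * intros q hq; left; split; apply truncate_lt.
      -- destruct (lt_total _ (truncate (S k) z) (truncate (S k) (fst q)))
           as [h | [h | h]]; [exact h | elim new; eauto | elim (hnone q hq h)].
      -- rewrite hz'; now apply hw, in_map.
  (* Only the digits below [k] must agree after this move, so digit [k] of the reply may be the
     large value [c]. *)
  + destruct (hM (map (fun q => digit k (snd q)) s)) as [c hc].
    destruct (truncate_replace (S k)
      (fun i => if Nat.eq_dec i k then c else digit i z) (snd p)) as (z' & hz' & hdz').
    exists z'; apply agree_cons; auto.
    * intros i hi; rewrite hdz' by lia; destruct (Nat.eq_dec i k); [lia | auto].
    * intros q hq.
      assert (hcq : digit k (snd q) < digit k z').
      { rewrite hdz' by lia; destruct (Nat.eq_dec k k); [| lia].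
        apply hc, in_map_iff; eauto. }
      destruct (lt_total _ (truncate (S k) z) (truncate (S k) (fst q)))
        as [h | [h | h]].
      (* Here [p] lies strictly below [q] already at level [S k], hence so do their partners. *)
      -- left; split; apply truncate_lt; [exact h |].
         rewrite hz'.
         destruct (ho p q hp hq) as [[_ l] | [[l _] | [l _]]]; [exact l | |].
         ++ rewrite l in hpz; elim (order_asym hpz h).
         ++ elim (order_asym l (order_trans hpz h)).
      -- elim new; eauto.
      (* By maximality of [p], [q] is not above it. If their truncations coincide, the digit [c]
         puts the reply above the partner of [q]; otherwise the truncations decide. *)
      -- right; right; split; [now apply truncate_lt |].
         destruct (ho p q hp hq) as [[l _] | [[_ l] | [_ l]]].
         ++ elim (hmax q hq h l).
         ++ apply truncate_lt_digit; congruence.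
         ++ apply truncate_lt; now rewrite hz'.
Qed.

End Strategy.

Lemma agree_swap X Y k (s : list (lex digits X * lex digits Y)) :
  agree k s -> agree k (map (fun p => (snd p, fst p)) s).
Proof.
intros [hd ho]; split.
- intros p' hp i hi; apply in_map_iff in hp.
  destruct hp as (p & <- & hp); symmetry; simpl; auto.
- intros p' q' hp hq; apply in_map_iff in hp; apply in_map_iff in hq.
  destruct hp as (p & <- & hp), hq as (q & <- & hq); simpl.
  apply same_order_flip; auto.
Qed.

Lemma ef_equiv_lex_digits (X Y : linear_order) (x0 : X) (y0 : Y) (n : nat) :
  (forall l : list M, exists c, forall x, In x l -> x < c) -> no_min X -> no_min Y ->
  ef_equiv (lex digits X) (lex digits Y) n.
Proof.
intros hM hX hY.
apply (@II_wins_system (lex digits X) (lex digits Y) (@agree X Y)).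
- intros s [_ ho]; apply partial_iso_iff; intros p q hp hq.
  pose proof (ho p q hp hq) as h; now rewrite !truncate_0 in h.
- intros k s x hs; exact (agree_forth y0 hM hY x hs).
(* A move in the second order is answered by the same strategy with the two sides exchanged. *)
- intros k s y hs.
  destruct (agree_forth x0 hM hX y (agree_swap hs)) as [x hx].
  exists x; apply agree_swap in hx; simpl in hx.
  rewrite map_map in hx; simpl in hx.
  erewrite map_ext in hx; [rewrite map_id in hx; exact hx |].
  now intros [].
- split; intros p; simpl; tauto.
Qed.

End Digits.

(** * Infinite powers of [omega] and [omega_star] *)

Lemma ef_equiv_omega_power (lambda : well_order) (X Y : linear_order) (x0 : X) (y0 : Y) n :
  ord_le ord_omega lambda -> no_min X -> no_min Y ->
  ef_equiv (lex (product (power omega lambda)) X) (lex (product (power omega lambda)) Y) n.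
Proof.
intros (e & e_mono & e_initial).
apply (@ef_equiv_lex_digits omega lambda e); auto.
(* Finite sets of naturals are strictly bounded above, as the reverse of [omega] has no least
   element. *)
intros l; apply (@no_min_list (reverse omega) 0 l).
intros i; exists (S i); apply Nat.lt_succ_diag_r.
Qed.

(** Reversing a product reverses each factor and keeps the elements, so the identity serves; only
    the coordinate equalities change sides. *)
Lemma reverse_omega_power_embedding (lambda : well_order) (X : linear_order) :
  @strict_embedding (lex (product (power omega lambda)) (reverse X))
    (reverse (lex (product (power omega_star lambda)) X)) (fun z => z).
Proof.
intros z w [h | [h (i & hi & hj)]]; [now left | right; split; [now symmetry |]].
exists i; split; [exact hi |]; intros j hij; symmetry; now apply hj.
Qed.

Lemma ef_equiv_omega_star_power (lambda : well_order) (X Y : linear_order)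
  (x0 : X) (y0 : Y) n :
  ord_le ord_omega lambda -> no_min (reverse X) -> no_min (reverse Y) ->
  ef_equiv (lex (product (power omega_star lambda)) X)
    (lex (product (power omega_star lambda)) Y) n.
Proof.
intros hl hX hY; apply II_wins_reverse.
refine (ef_equiv_iso (@reverse_omega_power_embedding lambda X) _
  (@reverse_omega_power_embedding lambda Y) _
  (ef_equiv_omega_power (X := reverse X) (Y := reverse Y) x0 y0 n hl hX hY)); eauto.
Qed.

Theorem theorem3p9
  (t : nat) (M : nat -> pointed_order) (m : nat -> nat)
  (M_omega : forall i, omega_or_star (M i))
  (M_alternate : forall i, M (S i) <> M i)
  (m_nonzero : forall i, m i <> 0)
  (lambda : well_order) (lambda_infinite : ord_le ord_omega lambda)
  (n' : nat) (n'_pos : 1 <= n')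
  (rest : factors) (rest_omega : forall j, omega_or_star (factor rest j)) :
  let A := product (prepend M m t
             (power (M t) lambda **
              power (M (S t)) (ord_fin (m (S t))) ** rest)) in
  let B := product (prepend M m t
             (power (M t) lambda ** power (M (S t)) (ord_fin n'))) in
  (forall n, ef_equiv A B n) /\ elem_equiv A B.
Proof.
intros A B.
assert (ef : forall n, ef_equiv A B n).
{ intros n; apply ef_equiv_prepend, ef_equiv_concat.
  (* Non-zero exponents give the powers of [M (S t)] an index, at which a coordinate can be moved
     past any given value. *)
  assert (first : forall k, k <> 0 -> exists i : ord_fin k, True).
  { intros k hk; now exists (exist _ 0 (proj1 (Nat.neq_0_lt_0 k) hk)). }
  destruct (first (m (S t))) as [i _]; [apply m_nonzero |].
  destruct (first n') as [i' _]; [lia |].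
  pose proof (M_alternate t) as hne.
  (* Alternation leaves two cases: [omega] followed by [omega_star], whose powers have no least
     element, and the dual. *)
  destruct (M_omega t) as [e | e], (M_omega (S t)) as [e' | e'];
    rewrite e, e' in *; try now elim hne.
  - apply ef_equiv_omega_power;
      auto using base_point, no_min_concat, no_min_power, no_min_omega_star.
  - apply ef_equiv_omega_star_power;
      auto using base_point, no_max_concat, no_max_power_omega.
}
split; [exact ef | now apply ef_equiv_elem_equiv].
Qed.
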